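(* Let $k,n,t$ be positive integers. (1) The sum, over all $\pi\in NC^k_B(n)$, of the number of unordered pairs $\{V,-V\}$ with $V\in\pi$, $V\neq -V$ and $|V|=tk$ equals $nk\binom{n(k+1)-t-1}{nk-1}$. (2) The number of $\pi\in NC^k_B(n)$ having a zero-block of size $2tk$ equals $\binom{n(k+1)-t-1}{nk-1}$.
   Context: For a positive integer $N$ let $[\pm N]=\{1,2,\dots,N,-1,-2,\dots,-N\}$, linearly ordered as $1<2<\dots<N<-1<-2<\dots<-N$ (equivalently, placed clockwise on a circle in this order). A non-crossing partition of type $B_N$ is a partition $\pi$ of $[\pm N]$ that is non-crossing with respect to this order (there are no $a<b<c<d$ with $a,c$ in one block and $b,d$ in a different block), such that for every block $V$ the set $-V=\{-x:x\in V\}$ is also a block, and there is at most one block $V$ with $V=-V$; such a block is called the zero-block. $NC_B(N)$ is the set of these. For positive integers $k,n$, $NC^k_B(n)$ is the set of $\pi\in NC_B(kn)$ all of whose blocks have size divisible by $k$. Binomial coefficients: $\binom{a}{b}=\frac{a!}{b!(a-b)!}$ if $0\le b\le a$ and $0$ otherwise. *)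

(* Defs.v *)
From mathcomp Require Import all_boot all_order all_algebra.
Set Implicit Arguments. Unset Strict Implicit. Unset Printing Implicit Defensive.

(* [±N] is encoded as 'I_(N + N): index i < N stands for the element i+1,
   index N + j (j < N) stands for -(j+1).  The ordinal order is then exactly
   1 < 2 < ... < N < -1 < ... < -N. *)
Notation pmN N := ('I_(N + N)).

Lemma pmN_pos N (i : pmN N) : 0 < N + N.
Proof. exact: leq_ltn_trans (leq0n i) (ltn_ord i). Qed.

Definition negpm N (i : pmN N) : pmN N :=
  Ordinal (ltn_pmod (i + N) (pmN_pos i)).

Definition negset N (V : {set pmN N}) : {set pmN N} := (@negpm N) @: V.

Definition noncrossing N (P : {set {set pmN N}}) : bool :=
  [forall V in P, forall W in P, (V != W) ==>
     ~~ [exists a : pmN N, exists b : pmN N, exists c : pmN N, exists d : pmN N,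
          [&& (a < b)%N, (b < c)%N, (c < d)%N,
              a \in V, c \in V, b \in W & d \in W]]].

Definition is_NCB N (P : {set {set pmN N}}) : bool :=
  [&& partition P [set: pmN N], noncrossing P,
      [forall V in P, negset V \in P] &
      #|[set V in P | negset V == V]| <= 1].

Definition NCkB (k n : nat) : {set {set {set pmN (k * n)}}} :=
  [set P | is_NCB P & [forall V in P, k %| #|V|]].

Definition npairs N (P : {set {set pmN N}}) (s : nat) : nat :=
  #|[set [set V; negset V] | V in [set V in P | (negset V != V) && (#|V| == s)]]|.

Definition has_zero_block N (P : {set {set pmN N}}) (s : nat) : bool :=
  [exists V in P, (negset V == V) && (#|V| == s)].

Definition binomZ (a b : int) : nat :=
  match a, b with
  | Posz a', Posz b' => 'C(a', b')
  | _, _ => 0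
  end.

(* Main.v *)
Require Import Defs.
From mathcomp Require Import all_boot all_order all_algebra.
From mathcomp Require Import perm zify.
Set Implicit Arguments. Unset Strict Implicit. Unset Printing Implicit Defensive.

(* A type B non-crossing partition P of [±N] is encoded by the N-periodic
   function f whose value at i is the size of the block of which i is the
   cyclically last element, and 0 if i is not last or lies in the zero-block.
   The zero-block then has size 2 (N - f 0 - ... - f (N-1)).  P is recovered
   from f by a ballot rule: the last element of the block of x is the least
   i >= x such that f x + ... + f i >= i - x + 1, and x is in the zero-block if
   there is no such i.  Every f with f 0 + ... + f (N-1) <= N occurs, so that,
   for N = kn and f = k g, both counts reduce to counting the tuples g of
   N natural numbers of sum n - t, resp. of sum at most n with a prescribed
   entry t. *)

(** * Residues and periodic sums *)

Lemma mod_window M i j : i <= j < i + M -> i = j %[mod M] -> j = i.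
Proof.
case/andP=> le_ij lt_j /esym/eqP; rewrite eqn_mod_dvd // => dv.
have [|pos] := posnP (j - i); first by lia.
by have := dvdn_leq pos dv; lia.
Qed.

Lemma mod_window2 M i j :
  i <= j < i + M + M -> i = j %[mod M] -> j = i \/ j = i + M.
Proof.
move=> lt_j eq_ij; have [lt|le] := ltnP j (i + M).
  by left; apply: (@mod_window M) => //; lia.
by right; apply: (@mod_window M); [lia | rewrite modnDr].
Qed.

Lemma sum_window M (g : nat -> nat) s :
  (forall x, g (x + M) = g x) ->
  \sum_(s <= y < s + M) g y = \sum_(0 <= y < M) g y.
Proof.
move=> gM; elim: s => // s IHs.
rewrite -IHs; case: M gM {IHs} => [|M] gM; first by rewrite !addn0 !big_geq.
by rewrite addSnnS addnS big_nat_recr ?[RHS]big_ltn ?gM //= 1?addnC; lia.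
Qed.

(** * From block sizes to a partition *)

Section Path.

Variables (N : nat) (f : nat -> nat).

Definition psum x := \sum_(0 <= m < x) f m.

Lemma psumS x : psum x.+1 = psum x + f x.
Proof. by rewrite /psum big_nat_recr. Qed.

(* psum x - x <= psum e - e, avoiding the truncated subtraction. *)
Definition reach x e := psum x + e <= psum e + x.

(** The default of [find] makes this [N] when no offset qualifies. Under [psum N <= N], testing [N]
    offsets is enough, by [closesP]. *)
Definition gap x := find (fun d => reach x (x + d).+1) (iota 0 N).

(** The ballot rule as a first return: with the height h x = psum x - x, the point i + 1 is the
    first one after x whose height is at least h x. *)
Definition closes x i :=
  [/\ x <= i, reach x i.+1 & forall m, x <= m < i -> ~~ reach x m.+1].

(* N + N marks the zero-block; other blocks are named by their last element. *)
Definition key x := if gap x < N then (x + gap x) %% (N + N) else N + N.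

Definition path_rel x y := key x == key y.

Lemma closes_gap x : gap x < N -> closes x (x + gap x).
Proof.
move=> gapN; split; first exact: leq_addr.
  have hasN : has (fun d => reach x (x + d).+1) (iota 0 N).
    by rewrite has_find size_iota.
  by have := nth_find 0 hasN; rewrite nth_iota.
move=> m /andP[le_xm lt_m]; have lt_d : m - x < gap x by lia.
have := before_find 0 lt_d; rewrite nth_iota ?add0n ?subnKC //; last by lia.
by move->.
Qed.

(** A step with [f i = 0] lowers the height, so it cannot be the step of a first return. *)
Lemma closes_pos x i : closes x i -> 0 < f i.
Proof.
case=> le_xi up_i min_i; have [eq_xi|neq] := eqVneq x i.
  by move: up_i; rewrite -eq_xi /reach psumS; lia.
have /min_i : x <= i.-1 < i by lia.
by rewrite prednK; move: up_i; rewrite /reach ?psumS; lia.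
Qed.

Lemma closes_refl i : 0 < f i -> closes i i.
Proof. by move=> ?; split=> //; [rewrite /reach psumS; lia | move=> m; lia]. Qed.

Hypothesis fN : forall x, f (x + N) = f x.

Lemma psumDN x : psum (x + N) = psum x + psum N.
Proof.
elim: x => [|x IHx]; first by rewrite {2}/psum big_geq.
by rewrite addSn !psumS IHx fN addnAC.
Qed.

Lemma reachDN x e : reach (x + N) (e + N) = reach x e.
Proof. by rewrite /reach !psumDN; lia. Qed.

Lemma gapDN x : gap (x + N) = gap x.
Proof.
by apply: eq_find => d; rewrite addnAC -addSn reachDN.
Qed.

Lemma keyDM x : key (x + (N + N)) = key x.
Proof.
have gapM : gap (x + (N + N)) = gap x by rewrite addnA !gapDN.
by rewrite /key gapM addnAC modnDr.
Qed.

Hypotheses (psumN_le : psum N <= N) (N_gt0 : 0 < N).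

(** The height changes by [psum N - N <= 0] over a period, so a level reached with [i >= x + N] was
    already reached one period earlier. First returns thus take at most [N] steps. *)
Lemma closesP x i : closes x i <-> gap x < N /\ i = x + gap x.
Proof.
split=> [[le_xi up_i min_i]|[gapN ->]]; last exact: closes_gap.
have lt_i : i < x + N.
  rewrite ltnNge; apply/negP=> le_i.
  have /negP[] : ~~ reach x (i - N).+1 by apply: min_i; lia.
  move: up_i; rewrite /reach.
  have -> : i.+1 = (i - N).+1 + N by lia.
  by rewrite psumDN; lia.
have gapN : gap x < N.
  rewrite -[N in _ < N](size_iota 0 N) -has_find; apply/hasP.
  by exists (i - x); rewrite ?mem_iota ?subnKC //; lia.
split=> //; have [_ up_g min_g] := closes_gap gapN.
have [lt|lt|//] := ltngtP i (x + gap x).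
  by have := min_g i; rewrite up_i le_xi lt => /(_ isT).
by have := min_i (x + gap x); rewrite up_g leq_addr lt => /(_ isT).
Qed.

Lemma closes_lt x i : closes x i -> i < x + N.
Proof. by move=> /closesP[? ->]; rewrite ltn_add2l. Qed.

Lemma key_closes x i : closes x i -> key x = i %% (N + N).
Proof. by move=> /closesP[gapN ->]; rewrite /key gapN. Qed.

Lemma keyP x : (exists2 i, closes x i & key x = i %% (N + N)) \/
  (key x = N + N /\ forall m, x <= m -> ~~ reach x m.+1).
Proof.
have [lt|ge] := ltnP (gap x) N.
  have cl := closes_gap lt.
  by left; exists (x + gap x); last exact: key_closes.
right; split=> [|m le_xm]; first by rewrite /key ltnNge ge.
apply/negP=> up_m.
pose p i := (x <= i) && reach x i.+1.
have exp : exists i, p i by exists m; rewrite /p le_xm.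
have [i /andP[le_xi up_i] min_i] := ex_minnP exp.
have : closes x i.
  split=> // l /andP[le_xl lt_l]; apply/negP=> up_l.
  by have := min_i l; rewrite /p le_xl up_l => /(_ isT); rewrite leqNgt lt_l.
by move=> /closesP[]; rewrite ltnNge ge.
Qed.

Lemma closesDN x i : closes x i -> closes (x + N) (i + N).
Proof. by move=> /closesP[? ->]; apply/closesP; rewrite gapDN addnAC. Qed.

Lemma closesDM x i : closes x i -> closes (x + (N + N)) (i + (N + N)).
Proof. by move=> cl; rewrite !addnA; do 2 apply: closesDN. Qed.

Lemma key_closes_neq x i : closes x i -> key x != N + N.
Proof.
move=> /key_closes->; have : i %% (N + N) < N + N by rewrite ltn_pmod; lia.
lia.
Qed.

Lemma path_relDN x y : path_rel (x + N) (y + N) = path_rel x y.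
Proof.
rewrite /path_rel /key !gapDN !(addnAC _ N).
have Mgt0 : 0 < N + N by lia.
have lt z : z %% (N + N) == N + N = false by have := ltn_pmod z Mgt0; lia.
case: ifP; case: ifP => _ _; rewrite ?lt ?(eq_sym (N + N)) ?lt //.
by rewrite eqn_modDr.
Qed.

(** Since [b] lies under the arc from [a] to [i], h b < h a <= h (i + 1), so [b] closes at [i] at
    the latest. If it is still open at [c], then h c < h b, and closing [b] before [i] would close
    [c] before [i]. *)
Lemma closes_between a b c i :
  a < b < c -> closes a i -> closes c i ->
  closes b i \/ exists2 j, closes b j & j < c.
Proof.
move=> /andP[ab bc] [_ up_a min_a] [ci up_c min_c].
have down m : a < m <= i -> ~~ reach a m.
  move=> am; have/min_a : a <= m.-1 < i by lia.
  by rewrite prednK //; lia.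
have up_b : reach b i.+1.
  by have := down b; move: up_a; rewrite /reach; lia.
have [[j cl_j _]|[_ /(_ i)]] := keyP b; last by rewrite up_b; lia.
have [lt_jc|le_cj] := ltnP j c; first by right; exists j.
left; suff -> : i = j by [].
have [bj up_j min_j] := cl_j.
have [lt|lt|//] := ltngtP i j.
  by have := min_j i; rewrite up_b; lia.
have /min_j : b <= c.-1 < j by lia.
rewrite prednK; last by lia.
have := down c; have := min_c j; move: up_j up_c up_a; rewrite /reach; lia.
Qed.

Lemma path_rel_nc_arc a b c d i :
  a < b -> b < c -> c < d -> d < a + (N + N) ->
  closes a i -> closes c i -> key b = key d -> key a = key b.
Proof.
move=> ab bc cd da cl_a cl_c eq_bd.
have [cl_b|[j cl_b lt_jc]] : closes b i \/ exists2 j, closes b j & j < c.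
    apply: (@closes_between a b c) => //; lia.
  by rewrite (key_closes cl_a) (key_closes cl_b).
have [[l cl_d eq_l]|[eqM _]] := keyP d; last first.
  by have := key_closes_neq cl_b; rewrite eq_bd eqM eqxx.
have [dl up_d min_d] := cl_d; have ltl := closes_lt cl_d.
have [ci _ _] := cl_c; have [bj _ _] := cl_b.
have l_eq : l = j + (N + N).
  have : l = j \/ l = j + (N + N); last by lia.
  apply: mod_window2; first by lia.
  by rewrite -(key_closes cl_b) eq_bd eq_l.
(* The element [d] is still open at a + 2N, whence h (a + 2N) < h d <= h (l + 1). But a + 2N closes
   only at i + 2N > l, whence h (l + 1) < h (a + 2N). *)
have [_ up_a min_a] := closesDM cl_a.
have := min_a l; have /min_d : d <= (a + (N + N)).-1 < l by lia.
rewrite prednK; last by lia.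
by move: up_d up_a; rewrite /reach; lia.
Qed.

Lemma path_rel_nc a b c d :
  a < b -> b < c -> c < d -> d < a + (N + N) ->
  path_rel a c -> path_rel b d -> path_rel a b.
Proof.
move=> ab bc cd da /eqP ac /eqP bd; apply/eqP.
have arcs x y z w : x < y -> y < z -> z < w -> w < x + (N + N) ->
    key x = key z -> key y = key w -> key x != N + N -> key x = key y.
  move=> xy yz zw wx exz eyw.
  have [[i cl_x ei]|[-> _]] := keyP x; last by rewrite eqxx.
  have [[j cl_z ej] _|[eqM _]] := keyP z; last by rewrite exz eqM eqxx.
  have ltj := closes_lt cl_z; have [zj _ _] := cl_z.
  have lti := closes_lt cl_x; have [xi _ _] := cl_x.
  have eij : i = j %[mod N + N] by rewrite -ei -ej.
  have [eq_ji|neq] := eqVneq i j.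
    by rewrite -eq_ji in cl_z; apply: (path_rel_nc_arc xy yz zw wx cl_x cl_z).
  have : j = i + (N + N).
    have [lt_ij|le_ji] := ltnP i j.
      have := @mod_window2 (N + N) i j _ eij; lia.
    have := @mod_window (N + N) j i _ (esym eij); lia.
  (* Here [z] and x + 2N close at the same point, so the arc lemma applies to the rotated quadruple
     z < w < x + 2N < y + 2N. *)
  move=> eq_j; rewrite eq_j in cl_z; have cl_x' := closesDM cl_x.
  rewrite exz eyw.
  by apply: (@path_rel_nc_arc z w (x + (N + N)) (y + (N + N)) _ _ _ _ _ cl_z cl_x');
     rewrite ?keyDM; lia.
(* Elements of the zero-block never close. If [a] is one and [b] is not, the rotation b < c < d < a
   + 2N puts the pair that closes first. *)
have [aM|aM] := eqVneq (key a) (N + N); last exact: (arcs a b c d).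
have [bM|bM] := eqVneq (key b) (N + N); first by rewrite aM bM.
rewrite ac -(arcs b c d (a + (N + N))) //; rewrite ?keyDM //; lia.
Qed.

Lemma sum_closes i : N <= i.+1 ->
  \sum_(i.+1 - N <= y < i.+1) ((gap y < N) && (i == y + gap y)) = f i.
Proof.
move=> leNi; pose p y := (gap y < N) && (i == y + gap y).
have pP y : p y <-> closes y i.
  rewrite closesP /p; split=> [/andP[-> /eqP]|[-> ->]] //.
  by rewrite eqxx.
have [f0|fi_gt0] := posnP (f i).
  rewrite f0 big1 // => y _; apply/eqP; rewrite eqb0; apply/negP=> /pP.
  by move/closes_pos; rewrite f0.
rewrite -/p; pose C l := \sum_(i.+1 - l <= y < i.+1) p y.
have CS l : l <= i -> C l.+1 = p (i - l) + C l.
  move=> le_li; rewrite {1}/C subSS big_ltn; last by lia.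
  by congr (_ + _); rewrite /C subSn.
(* Scanning leftwards from i, the height h x = psum x - x goes up by at most
   one per step; the elements closed at i are the strict records of h, which
   take the values h i, ..., h i + f i - 1 once each. *)
have inv l : 0 < l <= N -> [/\ C l <= f i,
     C l < f i -> forall l', l' < l ->
       psum (i - l') + i < psum i + C l + (i - l') &
     exists2 l0, l0 < l & (psum (i - l0) + i).+1 = psum i + C l + (i - l0)].
  elim: l => // l IHl lN; have [l0|l_gt0] := posnP l.
    have C1 : C l.+1 = 1.
      rewrite l0 CS // /C !subn0 big_geq ?addn0 //.
      by have /pP-> := closes_refl fi_gt0.
    rewrite C1; split=> // [_ l'|]; last by exists 0; rewrite ?subn0; lia.
    by rewrite l0; case: l' => [|//] _; rewrite subn0; lia.
  have [|Cle Cub [l0 lt0 eq0]] := IHl; first by lia.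
  have stepl : psum (i - l.-1) = psum (i - l) + f (i - l).
    by rewrite -psumS; congr psum; lia.
  have pC : p (i - l) = (C l < f i) && (psum i + C l + (i - l) <= psum (i - l) + i).
    apply/idP/idP=> [/pP[_ up_l min_l]|/andP[Clt up_l]].
      have /min_l : i - l <= (i - l0).-1 < i by lia.
      rewrite prednK; last by lia.
      by move: up_l; rewrite /reach psumS; lia.
    have ub := Cub Clt.
    apply/pP; split; [lia | |].
      by have := ub l.-1; rewrite /reach psumS; lia.
    move=> m lt_m; have := ub (i - m.+1).
    by rewrite /reach subKn; lia.
  rewrite (CS l) ?pC; last by lia.
  have [/andP[Clt up_l]|npl] := boolP ((C l < f i) && (psum i + C l + (i - l) <= psum (i - l) + i)).
    have ub := Cub Clt; have ubl := ub l.-1.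
    have eql : psum (i - l) + i = psum i + C l + (i - l) by lia.
    split; first by lia.
      by move=> _ l' lt'; have := ub l'; have [->|] := eqVneq l' l; lia.
    by exists l; lia.
  rewrite add0n; split=> //; last by exists l0; lia.
  move=> Clt l' lt'; have := Cub Clt l'; have [->|] := eqVneq l' l; last by lia.
  by move: npl; rewrite Clt; lia.
have [|Cle Cub _] := inv N; first by rewrite N_gt0 leqnn.
rewrite -[LHS]/(C N); apply/eqP; rewrite eqn_leq Cle leqNgt; apply/negP=> Clt.
(* A record still missing after [N] steps would leave h (i + 1 - N) < h i + C N <= h i + f i - 1 = h
   (i + 1), against [psum N <= N]. *)
have := Cub Clt N.-1; have := psumDN (i - N.-1).
have -> : i - N.-1 + N = i.+1 by lia.
by rewrite psumS; lia.
Qed.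

End Path.

(** * Periodic functions and sums of indicators *)

Lemma periodic_mod (T : Type) (g : nat -> T) M x :
  (forall x, g (x + M) = g x) -> g (x %% M) = g x.
Proof.
move=> gM; rewrite {2}(divn_eq x M) addnC.
by elim: (x %/ M) => [|q IHq]; rewrite ?addn0 // mulSnr addnA gM.
Qed.

Lemma sum_nat_bool_le1 (p : pred nat) a b :
  (forall x y, a <= x < b -> a <= y < b -> p x -> p y -> x = y) ->
  \sum_(a <= x < b) p x <= 1.
Proof.
elim: b => [|b IHb] inj; first by rewrite big_geq.
have [le_ab|lt_ba] := leqP a b; last by rewrite big_geq.
rewrite big_nat_recr //=; case pb: (p b).
  rewrite big_nat big1 // => x lt_x; apply/eqP; rewrite eqb0; apply/negP=> px.
  by have := inj x b _ _ px pb; lia.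
by rewrite addn0; apply: IHb => x y ltx lty; apply: inj; lia.
Qed.

Lemma sum_nat_bool_gt0 (p : pred nat) a b x :
  a <= x < b -> p x -> 0 < \sum_(a <= x < b) p x.
Proof.
move=> lt_x px; rewrite (bigD1_seq x) ?iota_uniq ?mem_index_iota //= px.
exact: leq_addr.
Qed.

(** * Type B non-crossing relations on the universal cover of the circle *)

Section Lifted.

Variables (N : nat) (R : rel nat).

Let M := N + N.

(* The natural numbers stand for the points of [±N] modulo 2N, and x + N for -x;
   blocks are the classes of R. *)
Record typeB_rel : Prop := TypeBRel {
  typeB_refl : reflexive R;
  typeB_sym : symmetric R;
  typeB_trans : transitive R;
  typeB_DM : forall x, R x (x + (N + N));
  typeB_DN : forall x y, R (x + N) (y + N) = R x y;
  typeB_nc : forall a b c d, a < b -> b < c -> c < d -> d < a + (N + N) ->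
    R a c -> R b d -> R a b }.

(* Since z = i + N is included, no element of a zero-block is last. *)
Definition last_elt i := all (fun z => ~~ R i z) (iota i.+1 N).

Definition block_size i := \sum_(0 <= y < N + N) R i y.

(** The function f of the encoding, read off from a relation. *)
Definition end_size i := last_elt i * block_size i.

Lemma last_eltP i : reflect (forall z, i < z <= i + N -> ~~ R i z) (last_elt i).
Proof.
apply: (iffP allP) => H z; first by move=> lt; apply: H; rewrite mem_iota; lia.
by rewrite mem_iota => lt; apply: H; lia.
Qed.

Hypothesis HR : typeB_rel.

Let Rxx : reflexive R := typeB_refl HR.
Let Rsym : symmetric R := typeB_sym HR.
Let Rtr x y z (xy : R x y) (yz : R y z) : R x z := typeB_trans HR xy yz.
Let RDN := typeB_DN HR.
Let Rnc := typeB_nc HR.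

Lemma relDMr x y : R x (y + M) = R x y.
Proof.
apply/idP/idP=> [xy|/Rtr]; last by apply; exact: typeB_DM.
by apply: (Rtr xy _); rewrite Rsym; exact: typeB_DM.
Qed.

Lemma relDMl x y : R (x + M) y = R x y.
Proof. by rewrite Rsym relDMr Rsym. Qed.

Lemma rel_modr x y : R x (y %% M) = R x y.
Proof. by apply: (periodic_mod y (g := R x)) => z; exact: relDMr. Qed.

Lemma rel_modl x y : R (x %% M) y = R x y.
Proof. by rewrite Rsym rel_modr Rsym. Qed.

Lemma last_eltDN i : last_elt (i + N) = last_elt i.
Proof.
apply/last_eltP/last_eltP => H z lt_z.
  by rewrite -RDN; apply: H; lia.
by have := H (z - N); rewrite -RDN subnK; [apply|]; lia.
Qed.

Lemma block_sizeDN i : block_size (i + N) = block_size i.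
Proof.
rewrite /block_size -(sum_window N) => [|y]; last by rewrite relDMr.
rewrite -[X in \sum_(X <= _ < _) _]add0n big_addn addKn.
by apply: eq_bigr => y _; rewrite RDN.
Qed.

Lemma end_sizeDN i : end_size (i + N) = end_size i.
Proof. by rewrite /end_size last_eltDN block_sizeDN. Qed.

Lemma last_elt_mod i : last_elt (i %% M) = last_elt i.
Proof.
by apply: (periodic_mod i (g := last_elt)) => x; rewrite /M addnA !last_eltDN.
Qed.

(** Either [j] comes at most [N] after [i], or i + 2N comes at most [N] after [j]; each contradicts
    lastness unless [i = j]. *)
Lemma last_elt_uniq i j :
  i <= j < i + M -> last_elt i -> last_elt j -> R i j -> i = j.
Proof.
move=> lt_ij /last_eltP Li /last_eltP Lj ij; have [//|neq] := eqVneq i j.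
have [le|lt] := leqP j (i + N); first by have := Li j; rewrite ij; lia.
have := Lj (i + M); rewrite relDMr Rsym ij /M; lia.
Qed.

Lemma zero_rel x y : R x (x + N) -> R x y -> R y (y + N).
Proof.
move=> xx xy; have yx : R y x by rewrite Rsym.
by apply: (Rtr yx (Rtr xx _)); rewrite RDN.
Qed.

Hypothesis N_gt0 : 0 < N.

Lemma last_elt_uniq_mod i j :
  last_elt i -> last_elt j -> R i j -> i = j %[mod M].
Proof.
rewrite -last_elt_mod -(last_elt_mod j) -rel_modl -rel_modr => Li Lj ij.
have Mgt0 : 0 < M by rewrite /M; lia.
have lti := ltn_pmod i Mgt0; have ltj := ltn_pmod j Mgt0.
have [le|/ltnW le] := leqP (i %% M) (j %% M).
  by apply: last_elt_uniq; rewrite // le; lia.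
by apply/esym/last_elt_uniq; rewrite 1?Rsym // le; lia.
Qed.

(** Any two diameters x, x + N and y, y + N cross or coincide, and crossing pairs are related. *)
Lemma zero_relP x y : R x (x + N) -> R y (y + N) -> R x y.
Proof.
have zeroM z : R (z %% M) (z %% M + N) = R z (z + N).
  apply: (periodic_mod z (g := fun z => R z (z + N))) => t.
  by rewrite addnAC relDMr relDMl.
rewrite -zeroM -(zeroM y) -(rel_modl x y) -(rel_modr (x %% M) y).
have Mgt0 : 0 < M by rewrite /M; lia.
have := ltn_pmod y Mgt0; have := ltn_pmod x Mgt0.
move: (x %% M) (y %% M) => {zeroM} {}x {}y.
wlog le_xy : x y / x <= y => [hw ltx lty xx yy|ltx lty xx yy].
  have [le|/ltnW le] := leqP x y; first exact: hw.
  by rewrite Rsym; apply: hw.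
have near z : x <= z < x + N -> R z (z + N) -> R x z.
  move=> lt_z zz; have [->|neq] := eqVneq x z; first exact: Rxx.
  by apply: (Rnc _ _ _ _ xx zz); lia.
have [lt|le] := ltnP y (x + N); first by apply: near; rewrite // le_xy.
have eqy : y = y - N + N by lia.
have zz : R (y - N) (y - N + N).
  by rewrite -eqy Rsym -relDMr /M addnA -eqy.
by rewrite eqy; apply: (Rtr (near _ _ zz) zz); move: ltx lty; rewrite /M; lia.
Qed.

(** The witness is the largest [i <= x + N] related to [x]. If a related [z] followed within [N],
    then z > x + N, and the pairs i, z and x + N, i + N would cross or [z] would be i + N; both put
    [x] in the zero-block. *)
Lemma ex_last_elt x :
  ~~ R x (x + N) -> exists2 i, x <= i < x + N & R x i && last_elt i.
Proof.
move=> nzx; pose p i := (x <= i <= x + N) && R x i.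
have exp : exists i, p i by exists x; rewrite /p Rxx leqnn leq_addr.
have bnd i : p i -> i <= x + N by case/andP=> /andP[].
have [i /andP[lt_i xi] max_i] := ex_maxnP exp bnd.
have lt : i < x + N.
  have [eq|] := eqVneq i (x + N); last by lia.
  by rewrite -eq xi in nzx.
exists i; first by lia.
rewrite xi; apply/last_eltP => z lt_z; apply/negP => iz.
have xz := Rtr xi iz.
have lt_xz : x + N < z.
  rewrite ltnNge; apply/negP=> le_z.
  by have := max_i z; rewrite /p xz; lia.
have ixz : R i (x + N).
  apply: (Rnc (d := i + N) _ _ _ _ iz); rewrite ?RDN //; try lia.
  have [eqz|] := eqVneq z (i + N); last by lia.
  by case/negP: nzx; apply: (@zero_rel i); rewrite -?eqz // Rsym.
by case/negP: nzx; apply: (Rtr xi ixz).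
Qed.

Lemma last_elt_nz i : last_elt i -> ~~ R i (i + N).
Proof. by move/last_eltP; apply; lia. Qed.

Lemma end_size_window x m :
  end_size m = \sum_(x <= y < x + M) (last_elt m && R m y).
Proof.
rewrite sum_window; last by move=> y; rewrite relDMr.
by rewrite /end_size big_distrr /=; apply: eq_bigr => y _; rewrite mulnb.
Qed.

(* Blocks ending in [x, e] are nested inside [x, e], and none contains x. *)
Lemma sum_end_size_le x e z : R x z -> x <= e < z -> z <= x + N ->
  \sum_(x <= m < e.+1) end_size m <= e - x.
Proof.
move=> xz /andP[le_xe lt_ez] le_z.
have nxm m : x <= m <= e -> last_elt m -> ~~ R x m.
  move=> lt_m /last_eltP/(_ z) H.
  apply/negP=> xm; have mz : R m z by rewrite Rsym in xm; apply: (Rtr xm xz).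
  by have := H; rewrite mz; lia.
have inside m : x <= m < e.+1 ->
    end_size m = \sum_(x <= y < e.+1) (last_elt m && R m y).
  move=> lt_m; rewrite (end_size_window x) (@big_cat_nat _ _ _ e.+1) //=; try lia.
  rewrite [X in _ + X]big_nat [X in _ + X]big1 ?addn0 // => y lt_y.
  apply/eqP; rewrite eqb0; apply/negP=> /andP[Lm my].
  have nx : ~~ R x m by apply: nxm.
  have neq : x != m by apply: contraNneq nx => ->.
  (* As [m] is last, an element [y] of its block beyond [e] lies beyond m + N >= z, so that x < m <
     z < y is a crossing. *)
  have [le|lt] := leqP y (m + N); first by have /last_eltP/(_ y) := Lm; rewrite my; lia.
  by case/negP: nx; apply: (Rnc _ _ _ _ xz my); lia.
rewrite (eq_big_nat _ _ inside) exchange_big_nat big_ltn //= ?ltnS //.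
rewrite [X in X + _]big_nat [X in X + _]big1 ?add0n => [|m lt_m]; last first.
  by apply/eqP; rewrite eqb0 Rsym; apply/negP=> /andP[/(nxm m lt_m)/negP].
rewrite -(subSS x e) -[leqRHS]muln1 -sum_nat_const_nat leq_sum // => y _.
apply: sum_nat_bool_le1 => m m' ltm ltm' /andP[Lm my] /andP[Lm' my'].
have mm' : R m m' by rewrite Rsym in my'; apply: (Rtr my my').
have [le|/ltnW le] := leqP m m'; first by apply: last_elt_uniq => //; lia.
by apply/esym/last_elt_uniq; rewrite 1?Rsym //; lia.
Qed.

(** Each y in [x, i] has its block ending in [x, i]: a block leaving this interval would cross the
    pair x, i. Hence the blocks ending there cover all i + 1 - x points. *)
Lemma sum_end_size_gt x i : last_elt i -> R x i -> x <= i < x + N ->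
  i < x + \sum_(x <= m < i.+1) end_size m.
Proof.
move=> Li xi lt_i.
have ends y : x <= y <= i -> exists2 m, y <= m <= i & R y m && last_elt m.
  move=> lt_y; pose p m := (y <= m <= i) && R y m.
  have exp : exists m, p m by exists y; rewrite /p Rxx; lia.
  have bnd m : p m -> m <= i by case/andP=> /andP[].
  have [m /andP[lt_m ym] max_m] := ex_maxnP exp bnd.
  exists m; first by lia.
  rewrite ym; have [->//|neq] := eqVneq m i.
  apply/last_eltP=> z lt_z; apply/negP=> mz.
  have lt_iz : i < z.
    rewrite ltnNge; apply/negP=> le_z.
    by have := max_m z; rewrite /p (Rtr ym mz); lia.
  suff mi : R m i by have := max_m i; rewrite /p (Rtr ym mi); lia.
  have [->//|neqx] := eqVneq m x.
  have xm : R x m by apply: (Rnc _ _ _ _ xi mz); lia.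
  by rewrite Rsym in xm; apply: (Rtr xm xi).
suff : i.+1 - x <= \sum_(x <= m < i.+1) end_size m by lia.
apply: (@leq_trans (\sum_(x <= m < i.+1) \sum_(x <= y < i.+1) (last_elt m && R m y))).
  rewrite exchange_big_nat -[leqLHS]muln1 -sum_nat_const_nat /= !big_nat.
  apply: leq_sum => y lt_y; have [|m lt_m /andP[ym Lm]] := ends y; first by lia.
  by apply: (@sum_nat_bool_gt0 _ _ _ m); rewrite ?Lm 1?Rsym //; lia.
apply: leq_sum => m _; rewrite (end_size_window x).
rewrite [leqRHS](@big_cat_nat _ _ _ i.+1) //=; try lia.
Qed.

(** Double counting of the pairs formed by a last element and a member of its block: each point
    outside the zero-block occurs once, and a full turn consists of two periods of [end_size]. *)
Lemma sum_end_size_total :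
  (\sum_(0 <= i < N) end_size i).*2 + \sum_(0 <= y < N + N) R y (y + N) = N + N.
Proof.
have -> : (\sum_(0 <= i < N) end_size i).*2 = \sum_(0 <= m < M) end_size m.
  rewrite [RHS](@big_cat_nat _ _ _ N) ?leq_addr //= -addnn; congr (_ + _).
  rewrite [RHS](_ : _ = \sum_(0 + N <= m < N + N) end_size m) // big_addn addKn.
  by apply: eq_bigr => i _; rewrite end_sizeDN.
have -> : \sum_(0 <= m < M) end_size m = \sum_(0 <= y < M) ~~ R y (y + N).
  rewrite (eq_bigr _ (fun m _ => end_size_window 0 m)) exchange_big_nat.
  apply: eq_bigr => y _; case: (boolP (R y (y + N))) => /= zy.
    rewrite big1 // => m _; apply/eqP; rewrite eqb0; apply/negP=> /andP[Lm my].
    by case/negP: (last_elt_nz Lm); apply: (zero_rel zy _); rewrite Rsym.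
  have Mgt0 : 0 < M by rewrite /M; lia.
  have [i lt_i /andP[yi Li]] := ex_last_elt zy.
  apply/eqP; rewrite eqn_leq; apply/andP; split; last first.
    apply: (@sum_nat_bool_gt0 _ _ _ (i %% M)); first by rewrite ltn_pmod.
    by rewrite last_elt_mod rel_modl Li Rsym.
  apply: sum_nat_bool_le1 => m m' ltm ltm' /andP[Lm my] /andP[Lm' my'].
  have mm' : R m m' by rewrite Rsym in my'; apply: (Rtr my my').
  by have := last_elt_uniq_mod Lm Lm' mm'; rewrite !modn_small.
rewrite -big_split /= (eq_bigr (fun=> 1)) => [|y _]; last by case: (R _ _).
by rewrite sum_nat_const_nat subn0 muln1.
Qed.

Lemma psum_end_size_le : psum end_size N <= N.
Proof. by have := sum_end_size_total; rewrite /psum; lia. Qed.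

Lemma reach_end_size x e : x <= e ->
  reach end_size x e.+1 = (e < x + \sum_(x <= m < e.+1) end_size m).
Proof.
move=> le_xe; rewrite /reach /psum [in leqRHS](@big_cat_nat _ _ _ x) //=; lia.
Qed.

(** The blocks ending in [x, m] have total size at most m - x for m < i, and at least i - x + 1 for
    m = i, so [i] is where the ballot rule first holds. *)
Lemma closes_last x i : x <= i < x + N -> R x i -> last_elt i ->
  closes end_size x i.
Proof.
move=> /[dup] lt_xi /andP[le_xi lt_i] xi Li; split=> // [|m lt_m].
  by rewrite reach_end_size //; apply: sum_end_size_gt.
rewrite reach_end_size -?leqNgt; last by lia.
by have := sum_end_size_le xi lt_m; lia.
Qed.

Lemma key_zero x : R x (x + N) -> key N end_size x = M.
Proof.
move=> zx; have [[i cl_i _]|[]//] :=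
  keyP end_sizeDN psum_end_size_le N_gt0 x.
have lt_i := closes_lt end_sizeDN psum_end_size_le N_gt0 cl_i.
have [le_xi] := cl_i; rewrite reach_end_size // => up_i _.
have := sum_end_size_le (e := i) zx; lia.
Qed.

(** One half of the correspondence: a relation is recovered from its end sizes, because the key of a
    point is the residue of the last element of its block, or [M] in the zero-block. *)
Lemma typeB_path_rel x y : R x y = path_rel N end_size x y.
Proof.
have lastP z : (R z (z + N) /\ key N end_size z = M) \/
    exists i, [/\ R z i, last_elt i & key N end_size z = i %% M].
  have [zz|nz] := boolP (R z (z + N)); first by left; rewrite key_zero.
  have [i lt_i /andP[zi Li]] := ex_last_elt nz.
  right; exists i; split=> //; have cl := closes_last lt_i zi Li.
  exact: (key_closes end_sizeDN psum_end_size_le N_gt0 cl).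
have Mgt0 : 0 < M by rewrite /M; lia.
rewrite /path_rel.
have [[zx ->]|[i [xi Li ->]]] := lastP x; have [[zy ->]|[j [yj Lj ->]]] := lastP y.
- by rewrite eqxx zero_relP.
- have -> : (M == j %% M) = false by have := ltn_pmod j Mgt0; lia.
  apply/negP=> xy; case/negP: (last_elt_nz Lj).
  by apply: (zero_rel zx _); apply: (Rtr xy yj).
- have -> : (i %% M == M) = false by have := ltn_pmod i Mgt0; lia.
  apply/negP=> xy; case/negP: (last_elt_nz Li); rewrite Rsym in xy.
  by apply: (zero_rel zy _); apply: (Rtr xy xi).
apply/idP/eqP=> [xy|eq_ij].
  apply: last_elt_uniq_mod => //; rewrite Rsym in xi.
  by apply: (Rtr xi _); apply: (Rtr xy _).
apply: (Rtr xi _); rewrite Rsym; apply: (Rtr yj _).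
by rewrite -rel_modr eq_ij rel_modr.
Qed.

End Lifted.

(** * The relation attached to block sizes is type B non-crossing *)

Section PathBlocks.

Variables (N : nat) (f : nat -> nat).
Hypotheses (N_gt0 : 0 < N) (fN : forall x, f (x + N) = f x).
Hypothesis psumN_le : psum f N <= N.

Lemma path_rel_typeB : typeB_rel N (path_rel N f).
Proof.
split; rewrite /path_rel.
- by move=> x; exact: eqxx.
- by move=> x y; rewrite eq_sym.
- by move=> y x z /eqP->.
- by move=> x; rewrite keyDM.
- exact: path_relDN.
- exact: path_rel_nc.
Qed.

(** If [f i > 0], then [i] closes itself, while a point of (i, i + N] closes strictly between i and
    i + 2N, hence in another class. If [f i = 0], then [i] closes later, or is in the zero-block
    together with i + N. *)
Lemma last_elt_path i : last_elt N (path_rel N f) i = (0 < f i).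
Proof.
apply/last_eltP/idP => [H|fi_gt0 z lt_z].
  rewrite lt0n; apply/eqP=> fi0.
  have [[j cl_j kj]|[kM _]] := keyP fN psumN_le N_gt0 i.
    have [le_ij _ _] := cl_j; have ltj := closes_lt fN psumN_le N_gt0 cl_j.
    have fj := closes_pos cl_j.
    have neq : i != j by apply/eqP=> eqj; rewrite -eqj fi0 in fj.
    have := H j; rewrite /path_rel kj (key_closes fN psumN_le N_gt0 (closes_refl fj)).
    by rewrite eqxx; lia.
  have := H (i + N); rewrite /path_rel kM.
  have : key N f (i + N) == N + N.
    move: kM; rewrite /key gapDN //; case: ifP; rewrite ?eqxx //.
    by have := ltn_pmod (i + gap N f i) (_ : 0 < N + N); lia.
  by rewrite eq_sym => ->; lia.
rewrite /path_rel (key_closes fN psumN_le N_gt0 (closes_refl fi_gt0)).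
apply/negP=> /eqP eq_k.
have [[j cl_j kj]|[kM _]] := keyP fN psumN_le N_gt0 z; last first.
  have := ltn_pmod i (_ : 0 < N + N); rewrite eq_k kM; lia.
have [le_zj _ _] := cl_j; have ltj := closes_lt fN psumN_le N_gt0 cl_j.
have := @mod_window (N + N) i j; rewrite eq_k kj; lia.
Qed.

(** The other half of the correspondence: the members of the block ending at [i] are the points
    closing at [i], counted by [sum_closes]. *)
Lemma end_size_path i : end_size N (path_rel N f) i = f i.
Proof.
rewrite /end_size last_elt_path; have [->|fi_gt0] := posnP (f i) => //.
rewrite mul1n.
have tB := path_rel_typeB.
(* Shifting by 2N keeps the window of 2N points ending at [i] inside the natural numbers. *)
rewrite -(block_sizeDN tB) -(block_sizeDN tB) -fN -fN.
have : 0 < f (i + N + N) by rewrite !fN.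
have : N + N <= i + N + N by lia.
move: (i + N + N) => {fi_gt0} {}i le_i fi_gt0.
have ki := key_closes fN psumN_le N_gt0 (closes_refl fi_gt0).
have keyi y : i.+1 - (N + N) <= y < i.+1 ->
    path_rel N f i y = (gap N f y < N) && (i == y + gap N f y).
  move=> lt_y; rewrite /path_rel ki; apply/eqP/andP=> [kiy|[gN /eqP eqi]]; last first.
    by have /(closesP fN psumN_le N_gt0)/(key_closes fN psumN_le N_gt0)-> :
      gap N f y < N /\ i = y + gap N f y.
  have [[j cl_j kj]|[kM _]] := keyP fN psumN_le N_gt0 y; last first.
    have := ltn_pmod i (_ : 0 < N + N); rewrite kiy kM; lia.
  suff eq_ij : i = j.
    by move: cl_j; rewrite -eq_ij => /(closesP fN psumN_le N_gt0)[-> /eqP].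
  have [le_yj _ _] := cl_j; have ltj := closes_lt fN psumN_le N_gt0 cl_j.
  have := @mod_window (N + N) i j; have := @mod_window (N + N) j i.
  by rewrite kiy kj; lia.
rewrite -[RHS](sum_closes fN psumN_le N_gt0); last by lia.
rewrite /block_size -(@sum_window _ _ (i.+1 - (N + N))) => [|y]; last first.
  by rewrite /path_rel keyDM.
rewrite subnK; last by lia.
rewrite (eq_big_nat _ _ (fun y lt_y => congr1 nat_of_bool (keyi y lt_y))).
rewrite (@big_cat_nat _ _ _ (i.+1 - N)) /=; try lia.
rewrite [X in X + _]big_nat [X in X + _]big1 // => y lt_y.
by apply/eqP; rewrite eqb0; lia.
Qed.

End PathBlocks.

(** * Set partitions and relations *)

Section Partitions.

Variable N : nat.
Hypothesis N_gt0 : 0 < N.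

Let M := N + N.

Lemma double_gt0 : 0 < N + N. Proof. by rewrite addn_gt0 N_gt0. Qed.

(** The covering map of the circle. *)
Definition rho x : pmN N := Ordinal (ltn_pmod x double_gt0).

Definition rel_of (P : {set {set pmN N}}) x y := rho y \in pblock P (rho x).

Definition part_of (R : rel nat) : {set {set pmN N}} :=
  equivalence_partition (fun i j : pmN N => R i j) [set: pmN N].

Lemma rho_val (i : pmN N) : rho i = i.
Proof. by apply: val_inj; rewrite /= modn_small. Qed.

Lemma rhoDN x : rho (x + N) = negpm (rho x).
Proof. by apply: val_inj; rewrite /= modnDml. Qed.

Lemma rhoDM x : rho (x + M) = rho x.
Proof. by apply: val_inj; rewrite /= modnDr. Qed.

Lemma negpmK : involutive (@negpm N).
Proof. by move=> i; rewrite -[i]rho_val -!rhoDN -addnA rhoDM. Qed.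

Lemma mem_negset (V : {set pmN N}) i : (i \in negset V) = (negpm i \in V).
Proof. by rewrite -{1}[i]negpmK mem_imset //; exact: inv_inj negpmK. Qed.

Lemma negsetK : involutive (@negset N).
Proof. by move=> V; apply/setP=> i; rewrite !mem_negset negpmK. Qed.

Section FromPartition.

Variable P : {set {set pmN N}}.
Hypothesis PB : is_NCB P.

Lemma NCB_partition : partition P setT. Proof. by case/and4P: PB. Qed.

Lemma NCB_trivIset : trivIset P.
Proof. by case/and3P: NCB_partition. Qed.

Lemma NCB_cover i : i \in cover P.
Proof. by rewrite (cover_partition NCB_partition) inE. Qed.

Lemma NCB_pblock i : pblock P i \in P.
Proof. by rewrite pblock_mem ?NCB_cover. Qed.

Lemma mem_NCB V : V \in P -> exists x, V = pblock P (rho x).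
Proof.
move=> PV; have /set0Pn[i Vi] : V != set0.
  by apply: contraTneq PV => ->; case/and3P: NCB_partition.
by exists i; rewrite rho_val (def_pblock NCB_trivIset PV).
Qed.

Lemma negset_pblock x : negset (pblock P (rho x)) = pblock P (rho (x + N)).
Proof.
apply/esym/def_pblock; first exact: NCB_trivIset.
  by case/and4P: PB => _ _ /forall_inP H _; apply/H/NCB_pblock.
by rewrite mem_negset rhoDN negpmK mem_pblock NCB_cover.
Qed.

Lemma rel_ofE x y : rel_of P x y = (pblock P (rho x) == pblock P (rho y)).
Proof. by rewrite eq_pblock ?NCB_trivIset ?NCB_cover. Qed.

Lemma rel_of_nc_small a b c d : a < b -> b < c -> c < d -> d < M ->
  rel_of P a c -> rel_of P b d -> rel_of P a b.
Proof.
move=> ab bc cd dM ac bd; rewrite rel_ofE; apply: contraLR isT => neq.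
have /and4P[_ /forall_inP/(_ _ (NCB_pblock (rho a))) nc _ _] := PB.
have := forall_inP nc _ (NCB_pblock (rho b)); rewrite neq /= => /negP[].
apply/existsP; exists (rho a); apply/existsP; exists (rho b).
apply/existsP; exists (rho c); apply/existsP; exists (rho d).
rewrite /= !modn_small ?ab ?bc ?cd /=; try by rewrite /M in dM *; lia.
by rewrite !mem_pblock !NCB_cover /=; apply/andP.
Qed.

Lemma NCB_typeB : typeB_rel N (rel_of P).
Proof.
have Rsym : symmetric (rel_of P) by move=> x y; rewrite !rel_ofE eq_sym.
have Rtr : transitive (rel_of P).
  by move=> y x z; rewrite !rel_ofE => /eqP->.
have RDM x : rel_of P x (x + M) by rewrite rel_ofE rhoDM.
have eqM x y : M <= y -> rel_of P x (y - M) = rel_of P x y.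
  by move=> le_y; rewrite !rel_ofE -(rhoDM (y - M)) subnK.
have relBM x y : M <= x -> M <= y -> rel_of P (x - M) (y - M) = rel_of P x y.
  by move=> le_x le_y; rewrite eqM // Rsym eqM // Rsym.
split=> //.
- by move=> x; rewrite rel_ofE.
- move=> x y; rewrite !rel_ofE -!negset_pblock.
  exact: (inj_eq (inv_inj negsetK)).
move=> a b c d ab bc cd; have [n] := ubnP a.
elim: n a b c d ab bc cd => // n IHn a b c d ab bc cd lt_a da ac bd.
(* Induction brings [a] below 2N. The points that have passed 2N are then moved back by 2N; they
   land before [a], and the rotated quadruple lies in a single turn. *)
have [aM|Ma] := ltnP a M; last first.
  have [Mb Mc Md] : [/\ M <= b, M <= c & M <= d] by split; lia.
  rewrite -(relBM _ _ Ma Mb); move: ac bd; rewrite -(relBM _ _ Ma Mc) -(relBM _ _ Mb Md).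
  by apply: IHn; rewrite -/M in da *; lia.
have [dM|Md] := ltnP d M; first exact: (rel_of_nc_small ab bc cd).
have [cM|Mc] := ltnP c M.
  rewrite -eqM // in bd; rewrite Rsym in bd.
  have da' : rel_of P (d - M) a by apply: (rel_of_nc_small _ ab bc cM bd ac); lia.
  by rewrite Rsym in da'; apply: Rtr da' bd.
have [bM|Mb] := ltnP b M.
  rewrite -eqM // Rsym in ac; rewrite -eqM // Rsym in bd.
  have cd' : rel_of P (c - M) (d - M).
    by apply: (rel_of_nc_small _ _ ab bM ac bd); lia.
  by rewrite Rsym in ac; apply: Rtr ac (Rtr _ _ _ cd' bd).
have bd' : rel_of P (b - M) (d - M) by rewrite relBM.
rewrite -eqM // Rsym in ac; rewrite -eqM //.
have bc' : rel_of P (b - M) (c - M).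
  by apply: (rel_of_nc_small _ _ _ aM bd' ac); lia.
by rewrite Rsym; apply: Rtr bc' ac.
Qed.

Lemma part_ofK : part_of (rel_of P) = P.
Proof.
rewrite -[RHS](equivalence_partition_pblock NCB_partition).
apply: eq_imset => i; apply/setP=> j; rewrite !inE /rel_of.
by rewrite !rho_val.
Qed.

Lemma card_pblock x : #|pblock P (rho x)| = block_size N (rel_of P) x.
Proof.
rewrite /block_size big_mkord -sum1_card big_mkcond /=; apply: eq_bigr => i _.
by rewrite /rel_of rho_val; case: ifP.
Qed.

Lemma zero_pblock x :
  (negset (pblock P (rho x)) == pblock P (rho x)) = rel_of P x (x + N).
Proof. by rewrite negset_pblock eq_sym rel_ofE. Qed.

(** The last elements of V and -V differ by [N] modulo 2N, so exactly one of the two lies in [0, N)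
    and indexes the pair. Positivity of [s] excludes the indices that are not last. *)
Lemma npairs_end_size s : 0 < s ->
  npairs P s = #|[set i : 'I_N | end_size N (rel_of P) i == s]|.
Proof.
move=> s_gt0; have tB := NCB_typeB.
have endP i : end_size N (rel_of P) i == s ->
    last_elt N (rel_of P) i /\ #|pblock P (rho i)| = s.
  by rewrite /end_size -card_pblock; case: (last_elt _ _ _) => /eqP; lia.
pose pr x := [set pblock P (rho x); negset (pblock P (rho x))].
have prN x : pr (x + N) = pr x.
  by rewrite /pr -negset_pblock negsetK setUC.
have pr_eq x y : rel_of P x y -> pr x = pr y.
  by rewrite rel_ofE /pr => /eqP->.
rewrite -(@card_in_imset _ _ (fun i : 'I_N => pr i)); last first.
  move=> i j; rewrite !inE => /endP[Li _] /endP[Lj _] eq_pr; apply: val_inj => /=.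
  have : pblock P (rho i) \in pr j by rewrite -eq_pr !inE eqxx.
  have lti := ltn_ord i; have ltj := ltn_ord j.
  rewrite !inE negset_pblock -!rel_ofE => /orP[ij|ij].
    have := last_elt_uniq_mod tB N_gt0 Li Lj ij.
    by rewrite !modn_small //; lia.
  have := last_elt_uniq_mod tB N_gt0 Li _ ij; rewrite (last_eltDN tB).
  by move=> /(_ Lj); rewrite !modn_small //; lia.
apply: eq_card => X; apply/imsetP/imsetP => [[V]|[i]].
  rewrite !inE => /andP[/mem_NCB[x eqV]]; rewrite eqV zero_pblock.
  case/andP=> nz /eqP sizeV ->.
  have [i _ /andP[xi Li]] := ex_last_elt tB N_gt0 nz.
  have [j [ltj Lj eqj]] : exists j, [/\ j < N, last_elt N (rel_of P) j &
      (j = i %% M \/ j + N = i %% M)].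
    have := ltn_pmod i double_gt0; rewrite -/M => lti.
    have Lm : last_elt N (rel_of P) (i %% M) by rewrite (last_elt_mod tB).
    have [lt|le] := ltnP (i %% M) N; first by exists (i %% M); split=> //; left.
    exists (i %% M - N); rewrite -(last_eltDN tB) subnK //; split=> //; last by right.
    by rewrite /M in lti *; lia.
  have xm : rel_of P x (i %% M) by rewrite (rel_modr tB).
  have prx : pr x = pr j.
    by case: eqj => [->|eqj]; rewrite (pr_eq _ _ xm) // -eqj prN.
  exists (Ordinal ltj) => //=.
  rewrite inE /= /end_size Lj mul1n -sizeV.
  have : pblock P (rho j) \in pr x by rewrite prx !inE eqxx.
  rewrite !inE -card_pblock => /orP[/eqP->//|/eqP->].
  by rewrite card_imset //; exact: inv_inj negpmK.
rewrite inE => /endP[Li sizei] ->; exists (pblock P (rho i)) => //.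
by rewrite !inE NCB_pblock zero_pblock sizei eqxx (last_elt_nz N_gt0 Li).
Qed.

(** By [sum_end_size_total], the zero-block takes up what the other blocks leave of the 2N points;
    [0 < s] excludes the case where nothing is left. *)
Lemma has_zero_block_end_size s : 0 < s ->
  has_zero_block P s =
  ((\sum_(0 <= i < N) end_size N (rel_of P) i).*2 + s == N + N).
Proof.
move=> s_gt0; have tB := NCB_typeB.
rewrite -[X in _ = (_ == X)](sum_end_size_total tB N_gt0) eqn_add2l.
have zeros x : rel_of P x (x + N) ->
    \sum_(0 <= y < N + N) rel_of P y (y + N) = #|pblock P (rho x)|.
  move=> zx; rewrite card_pblock; apply: eq_bigr => y _; congr nat_of_bool.
  apply/idP/idP=> [|xy]; first exact: (zero_relP tB N_gt0 zx).
  exact: (zero_rel tB zx).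
apply/exists_inP/eqP => [[V /mem_NCB[x ->]]|eqs].
  by rewrite zero_pblock => /andP[zx /eqP <-]; rewrite (zeros x).
have [/hasP[x _ zx]|/hasPn nz] :=
  boolP (has (fun y => rel_of P y (y + N)) (index_iota 0 (N + N))).
  exists (pblock P (rho x)); first exact: NCB_pblock.
  by rewrite zero_pblock zx eqs (zeros x) /=.
by move: s_gt0; rewrite eqs big_seq big1 // => y /nz /negPf->.
Qed.

End FromPartition.

Section FromRelation.

Variable R : rel nat.
Hypothesis RB : typeB_rel N R.

Lemma part_of_equiv : {in [set: pmN N] & &, equivalence_rel (fun i j : pmN N => R i j)}.
Proof.
move=> x y z _ _ _; split; first exact: (typeB_refl RB).
move=> xy; apply/idP/idP; last exact: (typeB_trans RB).
by apply: (typeB_trans RB); rewrite (typeB_sym RB).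
Qed.

Lemma mem_pblock_part_of (i j : pmN N) : (j \in pblock (part_of R) i) = R i j.
Proof. by rewrite (pblock_equivalence_partition part_of_equiv) ?inE. Qed.

Lemma rel_ofK x y : rel_of (part_of R) x y = R x y.
Proof. by rewrite /rel_of mem_pblock_part_of /= (rel_modl RB) (rel_modr RB). Qed.

Lemma part_of_NCB : is_NCB (part_of R).
Proof.
have parP : partition (part_of R) setT := equivalence_partitionP part_of_equiv.
have tI : trivIset (part_of R) by case/and3P: parP.
have covP i : i \in cover (part_of R) by rewrite (cover_partition parP) inE.
have memP V : V \in part_of R -> exists i, V = pblock (part_of R) i.
  move=> PV; have /set0Pn[i Vi] : V != set0.
    by apply: contraTneq PV => ->; case/and3P: parP.
  by exists i; rewrite (def_pblock tI PV).
have eqP' (i j : pmN N) : R i j -> pblock (part_of R) i = pblock (part_of R) j.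
  by move=> ij; apply/eqP; rewrite eq_pblock // mem_pblock_part_of.
have negR (i j : pmN N) : R (negpm i) (negpm j) = R i j.
  by rewrite (rel_modl RB) (rel_modr RB) (typeB_DN RB).
have negE i : negset (pblock (part_of R) i) = pblock (part_of R) (negpm i).
  by apply/setP=> j; rewrite mem_negset !mem_pblock_part_of -negR negpmK.
apply/and4P; split=> //.
- apply/forall_inP=> V /memP[v ->]; apply/forall_inP=> W /memP[w ->].
  apply/implyP=> neq; apply/negP=> /existsP[a] /existsP[b] /existsP[c] /existsP[d].
  case/and5P=> ab bc cd; rewrite !mem_pblock_part_of => va /and3P[vc wb wd].
  case/eqP: neq; rewrite (eqP' _ _ va) (eqP' _ _ wb); apply: eqP'.
  have [Rsym Rtr] := (typeB_sym RB, typeB_trans RB).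
  apply: (typeB_nc RB ab bc cd); first by have := ltn_ord d; lia.
    by rewrite Rsym in va; apply: Rtr va vc.
  by rewrite Rsym in wb; apply: Rtr wb wd.
- by apply/forall_inP=> V /memP[v ->]; rewrite negE pblock_mem.
apply/card_le1_eqP => V W; rewrite !inE => /andP[/memP[v ->] zv] /andP[/memP[w ->] zw].
have zero (i : pmN N) : negset (pblock (part_of R) i) == pblock (part_of R) i -> R i (i + N).
  by rewrite negE eq_sym eq_pblock // mem_pblock_part_of (rel_modr RB).
by apply/eqP'/(zero_relP RB N_gt0); apply: zero.
Qed.

End FromRelation.

End Partitions.

Lemma eq_end_size N (R R' : rel nat) : R =2 R' -> end_size N R =1 end_size N R'.
Proof.
move=> eqR i; rewrite /end_size /block_size (eq_bigr _ (fun y _ => congr1 nat_of_bool (eqR i y))).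
by congr (_ * _); congr nat_of_bool; apply: eq_all => z; rewrite eqR.
Qed.

Lemma eq_path_rel N f f' : f =1 f' -> path_rel N f =2 path_rel N f'.
Proof.
move=> eqf; have eqp x : psum f x = psum f' x by apply: eq_bigr.
have eqg x : gap N f x = gap N f' x.
  by apply: eq_find => d; rewrite /reach !eqp.
by move=> x y; rewrite /path_rel /key !eqg.
Qed.

Lemma eq_part_of N (R R' : rel nat) : R =2 R' -> part_of N R = part_of N R'.
Proof.
by move=> eqR; apply: eq_imset => i; apply/setP=> j; rewrite !inE eqR.
Qed.

(** * Counting *)

(** An entry never exceeds the sum, so the bound on entries can be lowered from [n] to [q], as the
    stars and bars counts require. *)
Lemma card_tuple_sum_pred m n q (p : pred nat) :
  q <= n -> (forall s, p s -> s <= q) ->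
  #|[set u : m.-tuple 'I_n.+1 | p (\sum_(i <- u) i)]| =
  #|[set u : m.-tuple 'I_q.+1 | p (\sum_(i <- u) i)]|.
Proof.
move=> le_qn pq; have le_qn1 : q.+1 <= n.+1 by [].
pose h (u : m.-tuple 'I_q.+1) := map_tuple (widen_ord le_qn1) u.
have inj_h : injective h.
  move=> u v /(congr1 val) /= /inj_map eq_uv; apply/val_inj/eq_uv.
  by move=> i j /(congr1 val) /= /val_inj.
rewrite -(card_imset _ inj_h); apply: eq_card => u; rewrite inE.
apply/idP/imsetP => [pu|[v + ->]]; last by rewrite inE big_map.
have le_u (i : 'I_n.+1) : i \in u -> i < q.+1.
  move=> ui; rewrite ltnS; apply: leq_trans (pq _ pu).
  by rewrite (big_rem i ui) /= leq_addr.
have eqhu : u = h (map_tuple (fun i : 'I_n.+1 => inord i) u).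
  apply: val_inj; rewrite /= -map_comp -[LHS]map_id; apply/eq_in_map => i ui.
  by apply: val_inj; rewrite /= inordK ?le_u.
exists (map_tuple (fun i : 'I_n.+1 => inord i) u); rewrite // inE.
by move: pu; rewrite {1}eqhu big_map.
Qed.

Lemma card_tuple_sum_eq m n q : 0 < m -> q <= n ->
  #|[set u : m.-tuple 'I_n.+1 | \sum_(i <- u) i == q]| = 'C(m.-1 + q, m.-1).
Proof.
case: m => // m _ le_qn; rewrite -card_ord_partitions.
by apply: (@card_tuple_sum_pred _ _ _ (pred1 q)) => // s /eqP->.
Qed.

Lemma card_tuple_sum_le m n q : q <= n ->
  #|[set u : m.-tuple 'I_n.+1 | \sum_(i <- u) i <= q]| = 'C(m + q, m).
Proof.
move=> le_qn; rewrite -card_partial_ord_partitions.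
by apply: (@card_tuple_sum_pred _ _ _ (fun s => s <= q)).
Qed.

(** A transposition moves coordinate [i] to the front; what remains is a shorter tuple of sum at
    most [n - t]. *)
Lemma card_tuple_coord m n t (i : 'I_m) : t <= n ->
  #|[set u : m.-tuple 'I_n.+1 | (\sum_(j <- u) j <= n) && (tnth u i == t :> nat)]|
  = 'C(m.-1 + (n - t), m.-1).
Proof.
case: m i => [[]//|m] i le_tn.
pose sw (u : m.+1.-tuple 'I_n.+1) := [tuple tnth u (tperm ord0 i j) | j < m.+1].
have swK : involutive sw.
  by move=> u; apply: eq_from_tnth => j; rewrite !tnth_mktuple tpermK.
have lt_tn : t < n.+1 by [].
pose cns (v : m.-tuple 'I_n.+1) := sw (cons_tuple (Ordinal lt_tn) v).
have inj_cns : injective cns.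
  by move=> u v /(inv_inj swK) /(congr1 val) [] /val_inj.
rewrite -(card_tuple_sum_le m (leq_subr t n)) -(card_imset _ inj_cns).
have sum_sw u : \sum_(j <- sw u) j = \sum_(j <- u) j.
  rewrite !big_tuple [RHS](reindex_perm (tperm ord0 i)) /=.
  by apply: eq_bigr => j _; rewrite tnth_mktuple.
apply: eq_card => u; rewrite inE; apply/andP/imsetP => [[le_u /eqP ui]|[v + ->]].
  have [x [v eq_v]] : exists x v, sw u = cons_tuple x v.
    by case/tupleP: (sw u) => x v; exists x, v; apply: val_inj.
  have eq_x : x = Ordinal lt_tn.
    apply: val_inj; rewrite /= -ui.
    by have := congr1 (fun w => tnth w ord0) eq_v; rewrite tnth_mktuple tpermL tnth0 => ->.
  exists v; last by rewrite /cns -eq_x -eq_v swK.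
  by move: le_u; rewrite inE -sum_sw eq_v big_cons eq_x /=; lia.
rewrite inE /cns sum_sw tnth_mktuple tpermR tnth0 big_cons /= eqxx => le_v.
by split=> //; lia.
Qed.

(** * The bijection between tuples of sum at most n and the partitions counted *)

Section Count.

Variables k n : nat.
Hypotheses (k_gt0 : 0 < k) (n_gt0 : 0 < n).

Let N := k * n.

Let N_gt0 : 0 < N. Proof. by rewrite muln_gt0 k_gt0. Qed.

Let G := [set u : N.-tuple 'I_n.+1 | \sum_(i <- u) i <= n].

Definition sizes (u : N.-tuple 'I_n.+1) x : nat := k * nth ord0 u (x %% N).

Definition NC_of (u : N.-tuple 'I_n.+1) := part_of N (path_rel N (sizes u)).

Lemma sizesDN u x : sizes u (x + N) = sizes u x.
Proof. by rewrite /sizes modnDr. Qed.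

Lemma sizes_ord u (i : 'I_N) : sizes u i = k * tnth u i.
Proof. by rewrite /sizes modn_small // (tnth_nth ord0). Qed.

Lemma sum_sizes u : \sum_(0 <= i < N) sizes u i = k * \sum_(i <- u) i.
Proof.
rewrite big_mkord big_tuple big_distrr /=; apply: eq_bigr => i _.
exact: sizes_ord.
Qed.

Lemma psum_sizes u : u \in G -> psum (sizes u) N <= N.
Proof. by rewrite inE /psum sum_sizes leq_pmul2l. Qed.

Lemma path_rel_sizes u : u \in G -> typeB_rel N (path_rel N (sizes u)).
Proof. by move=> Gu; apply: path_rel_typeB; [| exact: sizesDN | exact: psum_sizes]. Qed.

Lemma NC_of_NCB u : u \in G -> is_NCB (NC_of u).
Proof. by move=> Gu; apply: part_of_NCB; last exact: path_rel_sizes. Qed.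

Lemma end_size_NC_of u i : u \in G ->
  end_size N (rel_of N_gt0 (NC_of u)) i = sizes u i.
Proof.
move=> Gu; rewrite -[RHS](end_size_path N_gt0 (sizesDN u) (psum_sizes Gu)).
by apply: eq_end_size => x y; rewrite rel_ofK //; exact: path_rel_sizes.
Qed.

Lemma NC_of_inj : {in G &, injective NC_of}.
Proof.
move=> u v Gu Gv eq_uv; apply: eq_from_tnth => i; apply: val_inj => /=.
apply/eqP; rewrite -(eqn_pmul2l k_gt0) -!sizes_ord.
by rewrite -!end_size_NC_of // eq_uv.
Qed.

(** Non-zero blocks have size [k] times an entry; the zero-block has size 2kn minus twice a multiple
    of [k]. *)
Lemma NC_of_NCkB u : u \in G -> NC_of u \in NCkB k n.
Proof.
move=> Gu; have PB := NC_of_NCB Gu; rewrite inE PB /=.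
have tB := NCB_typeB N_gt0 PB.
apply/forall_inP=> V /(mem_NCB N_gt0 PB)[x ->].
have [zx|nz] := boolP (rel_of N_gt0 (NC_of u) x (x + N)).
  have := has_zero_block_end_size N_gt0 PB.
  have V_gt0 : 0 < #|pblock (NC_of u) (rho N_gt0 x)|.
    by apply/card_gt0P; exists (rho N_gt0 x); rewrite mem_pblock (NCB_cover PB).
  move=> /(_ _ V_gt0).
  have -> : has_zero_block (NC_of u) #|pblock (NC_of u) (rho N_gt0 x)|.
    apply/exists_inP; exists (pblock (NC_of u) (rho N_gt0 x)).
      exact: NCB_pblock.
    by rewrite zero_pblock // zx eqxx.
  rewrite (eq_bigr _ (fun i _ => end_size_NC_of i Gu)) sum_sizes => /esym/eqP eqN.
  have : k %| (k * \sum_(i <- u) i).*2 + #|pblock (NC_of u) (rho N_gt0 x)|.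
    by rewrite eqN dvdn_add ?dvdn_mulr.
  by rewrite dvdn_addr // -muln2 -mulnA dvdn_mulr.
have [i _ /andP[xi Li]] := ex_last_elt tB N_gt0 nz.
have -> : pblock (NC_of u) (rho N_gt0 x) = pblock (NC_of u) (rho N_gt0 i).
  by apply/eqP; rewrite -rel_ofE.
rewrite card_pblock; have := end_size_NC_of i Gu.
by rewrite /end_size Li mul1n => ->; rewrite dvdn_mulr.
Qed.

Lemma NCkB_NC_of P : P \in NCkB k n -> exists2 u, u \in G & P = NC_of u.
Proof.
rewrite inE => /andP[PB /forall_inP kP].
have tB := NCB_typeB N_gt0 PB.
set f := end_size N (rel_of N_gt0 P).
have kf i : k %| f i.
  rewrite /f /end_size -card_pblock; apply/dvdn_mull/kP.
  exact: NCB_pblock.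
have fN i : f (i + N) = f i by exact: end_sizeDN.
have sum_f : \sum_(0 <= i < N) f i <= N by exact: (psum_end_size_le tB N_gt0).
(* A value of [f] is at most its sum over a period, hence at most kn. *)
have f_le i : f i %/ k < n.+1.
  rewrite ltnS leq_divLR //; apply: leq_trans (_ : N <= _); last by rewrite mulnC.
  rewrite -(periodic_mod i fN); apply: leq_trans sum_f.
  by rewrite (bigD1_seq (i %% N)) ?iota_uniq ?mem_index_iota ?ltn_pmod //= leq_addr.
pose u := [tuple (Ordinal (f_le i)) | i < N].
have fu i : sizes u i = f i.
  rewrite -(periodic_mod i fN) /sizes.
  have lti : i %% N < N by rewrite ltn_pmod.
  rewrite -(tnth_nth ord0 u (Ordinal lti)) tnth_mktuple /= mulnC divnK //.
have Gu : u \in G.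
  by rewrite inE -(leq_pmul2l k_gt0) -sum_sizes (eq_bigr _ (fun i _ => fu i)).
exists u => //; rewrite -[LHS](part_ofK N_gt0 PB); apply: eq_part_of => x y.
by rewrite (typeB_path_rel tB N_gt0) (eq_path_rel _ fu).
Qed.

Lemma NCkB_imset : NCkB k n = NC_of @: G.
Proof.
apply/setP=> P; apply/idP/imsetP=> [/NCkB_NC_of//|[u Gu ->]].
exact: NC_of_NCkB.
Qed.

Lemma npairs_NC_of u t : u \in G -> 0 < t ->
  npairs (NC_of u) (t * k) = \sum_(i < N) (tnth u i == t :> nat).
Proof.
move=> Gu t_gt0; rewrite (npairs_end_size N_gt0 (NC_of_NCB Gu)) ?muln_gt0 ?t_gt0 //.
rewrite -sum1dep_card big_mkcond /=; apply: eq_bigr => i _.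
by rewrite end_size_NC_of // sizes_ord mulnC eqn_pmul2r //; case: eqP.
Qed.

Lemma zero_NC_of u t : u \in G -> 0 < t ->
  has_zero_block (NC_of u) (2 * t * k) = (\sum_(i <- u) i + t == n).
Proof.
move=> Gu t_gt0; rewrite (has_zero_block_end_size N_gt0 (NC_of_NCB Gu)); last first.
  by rewrite !muln_gt0 t_gt0.
rewrite (eq_bigr _ (fun i _ => end_size_NC_of i Gu)) sum_sizes.
rewrite addnn -!mul2n -mulnA -mulnDr eqn_pmul2l // (mulnC t) -mulnDr.
by rewrite eqn_pmul2l.
Qed.

End Count.

(** The upper index is (nk - 1) + (n - t); for [t > n] it is negative or below the lower index. *)
Lemma binomZ_le k n t : 0 < k -> 0 < n ->
  binomZ ((n * (k + 1))%:Z - t%:Z - 1) ((n * k)%:Z - 1) =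
  if t <= n then 'C((n * k).-1 + (n - t), (n * k).-1) else 0.
Proof.
move=> k_gt0 n_gt0; have N_gt0 : 0 < n * k by rewrite muln_gt0 n_gt0.
have -> : ((n * k)%:Z - 1 = Posz (n * k).-1)%R by lia.
case: leqP => [le_tn|lt_nt].
  have -> // : ((n * (k + 1))%:Z - t%:Z - 1 = Posz ((n * k).-1 + (n - t)))%R.
  by rewrite mulnDr muln1; lia.
case E: ((n * (k + 1))%:Z - t%:Z - 1)%R => [a|//] /=.
by rewrite bin_small //; move: E; rewrite mulnDr muln1; lia.
Qed.

Theorem theorem2 (k n t : nat) (hk : 0 < k) (hn : 0 < n) (ht : 0 < t) :
  (\sum_(P in NCkB k n) npairs P (t * k) =
     n * k * binomZ ((n * (k + 1))%:Z - t%:Z - 1) ((n * k)%:Z - 1))%N /\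
  #|[set P in NCkB k n | has_zero_block P (2 * t * k)]| =
     binomZ ((n * (k + 1))%:Z - t%:Z - 1) ((n * k)%:Z - 1).
Proof.
rewrite binomZ_le // [n * k]mulnC.
have N_gt0 : 0 < k * n by rewrite muln_gt0 hk.
pose G := [set u : (k * n).-tuple 'I_n.+1 | \sum_(i <- u) i <= n].
rewrite (NCkB_imset hk hn) -/G; have inj : {in G &, injective (@NC_of k n)} := NC_of_inj hk hn.
split.
  rewrite big_imset //= (eq_bigr _ (fun u Gu => npairs_NC_of hk hn Gu ht)).
  (* The factor kn is the number of positions [i]: each one contributes the same number of tuples
     with entry [t] there. *)
  rewrite exchange_big -[X in _ = X * _]card_ord -sum_nat_const; apply: eq_bigr => i _.
  transitivity #|[set u in G | tnth u i == t :> nat]|.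
    by rewrite -sum1dep_card big_mkcondr; apply: eq_bigr => u _; case: eqP.
  case: leqP => [le_tn|lt_nt].
    rewrite -(card_tuple_coord i le_tn); apply: eq_card => u.
    by rewrite !inE.
  apply: eq_card0 => u; rewrite !inE; apply/negP=> /andP[_ /eqP eq_t].
  by have := ltn_ord (tnth u i); rewrite eq_t ltnS leqNgt lt_nt.
transitivity #|[set u in G | \sum_(i <- u) i + t == n]|.
  rewrite -(card_in_imset (sub_in2 _ inj)); last by move=> u; rewrite inE => /andP[].
  apply: eq_card => P; rewrite inE; apply/andP/imsetP => [[/imsetP[u Gu ->]]|[u + ->]].
    by rewrite zero_NC_of // => eq_n; exists u; rewrite // inE Gu.
  by rewrite inE => /andP[Gu eq_n]; rewrite zero_NC_of // imset_f.
case: leqP => [le_tn|lt_nt].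
  rewrite -(card_tuple_sum_eq N_gt0 (leq_subr t n)); apply: eq_card => u.
  by rewrite !inE; move: (\sum_(i <- u) i) => s; lia.
by apply: eq_card0 => u; rewrite !inE; move: (\sum_(i <- u) i) => s; lia.
Qed.
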